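(* Let $G$ be a finite nonabelian AC-group of order $n$ with center of order $m$. Let $C_G(x_1),C_G(x_2),\dots,C_G(x_t)$ be all the distinct centralizers of noncentral elements of $G$, and let $m_i=|C_G(x_i)\setminus Z(G)|$ for $i=1,2,\dots,t$. Then $$\kappa(G)=n^{m-1}m^{t-1}\prod_{i=1}^{t}(m_i+m)^{m_i-1}.$$ In particular, if $G$ is a centerless AC-group, then $$\kappa(G)=\prod_{i=1}^{t}(m_i+1)^{m_i-1}=\prod_{i=1}^{t}|C_G(x_i)|^{|C_G(x_i)|-2}.$$
   Context: A nonabelian group $G$ is an AC-group if the centralizer of every noncentral element of $G$ is abelian. $Z(G)$ is the center of $G$; $G$ is centerless if $Z(G)=1$. $C_G(x)$ is the centralizer of $x$ in $G$. For a finite group $G$, the commuting graph $\mathcal{C}(G)$ is the simple graph with vertex set $G$ in which two distinct elements are adjacent if and only if they commute. $\kappa(G)$ denotes the number of spanning trees of $\mathcal{C}(G)$. *)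

(* Defs.v *)
From mathcomp Require Import all_boot all_fingroup all_solvable.
Set Implicit Arguments.
Unset Strict Implicit.
Unset Printing Implicit Defensive.

Record sgraph := SGraph {
  svertex :> finType;
  sadj : rel svertex;
  sadj_sym : symmetric sadj;
  sadj_irr : irreflexive sadj
}.

Definition edges (g : sgraph) : {set {set g}} :=
  [set [set p.1; p.2] | p : g * g & sadj p.1 p.2].

(* The adjacency relation of the graph on V whose set of edges is F. *)
Definition edge_rel (V : finType) (F : {set {set V}}) : rel V :=
  [rel u v | [set u; v] \in F].

Definition connected_rel (V : finType) (e : rel V) : bool :=
  [forall u, forall v, connect e u v].

(* No simple cycle of length at least 3; such a cycle has at most #|V|
   vertices, so the quantification is finite (see acyclicP). *)
Definition acyclic_rel (V : finType) (e : rel V) : bool :=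
  [forall k : 'I_#|V|.+1, forall s : k.-tuple V, (2 < k) ==> ~~ ucycleb e s].

Lemma acyclicP (V : finType) (e : rel V) :
  reflect (forall s : seq V, 2 < size s -> ~ ucycle e s) (acyclic_rel e).
Proof.
apply: (iffP forallP) => [ac s s_gt2 cs | ac k].
  have s_le : size s < #|V|.+1.
    by case/andP: cs => _ /card_uniqP <-; rewrite ltnS max_card.
  have /forallP/(_ (in_tuple s)) := ac (Ordinal s_le).
  by move/implyP/(_ s_gt2)/negP; apply.
apply/forallP => s; apply/implyP => k_gt2; apply/negP.
by apply: ac; rewrite size_tuple.
Qed.

Definition is_spanning_tree (g : sgraph) (F : {set {set g}}) : bool :=
  [&& F \subset edges g, connected_rel (edge_rel F) & acyclic_rel (edge_rel F)].

Definition num_spanning_trees (g : sgraph) : nat :=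
  #|[set F : {set {set g}} | is_spanning_tree F]|.

Section CommutingGraph.
Variables (gT : finGroupType) (G : {group gT}).

Definition commuting_adj : rel (subg_of G) :=
  [rel x y | (x != y) && (x * y == y * x)%g].

Lemma commuting_adj_sym : symmetric commuting_adj.
Proof. by move=> x y; rewrite /commuting_adj /= eq_sym [(x * y == _)%g]eq_sym. Qed.

Lemma commuting_adj_irr : irreflexive commuting_adj.
Proof. by move=> x; rewrite /commuting_adj /= eqxx. Qed.

Definition commuting_graph : sgraph :=
  SGraph commuting_adj_sym commuting_adj_irr.

Definition kappa : nat := num_spanning_trees commuting_graph.

Definition AC_group : bool :=
  ~~ abelian G && [forall x in G :\: 'Z(G)%g, abelian 'C_G[x]%g].

End CommutingGraph.

(* Main.v *)
(** The noncentral elements of an AC-group are partitioned by their centralizers,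
    and two of them commute exactly when their centralizers coincide.  So the
    commuting graph is the join of a clique on 'Z(G) with a disjoint union of
    cliques of sizes m_i, whose spanning trees are counted by a determinant.

    Spanning trees correspond to parent maps f, with f r = r, every other vertex
    adjacent to its parent, and all orbits reaching r.  Expanding by rows the
    determinant of the Laplacian whose row r is replaced by e_r gives a sum over
    all the maps f with f r = r and f v adjacent to v; the term of f is 1 if f is
    a parent map, and 0 otherwise.  For the graph at hand this determinant is
    reduced to a diagonal one by rank-one updates and det (1 + AB) = det (1 + BA). *)
Require Import Defs.
From mathcomp Require Import all_boot all_fingroup all_solvable.
From mathcomp Require Import all_algebra ring.

Set Implicit Arguments.
Unset Strict Implicit.
Unset Printing Implicit Defensive.
Import GRing.Theory Num.Theory.

(** * Spanning trees as parent maps *)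

Section ParentFunctions.
Variables (g : sgraph) (r : g).
Implicit Types (f : {ffun g -> g}) (F : {set {set g}}) (u v w : g).

Definition rooted_map f : bool :=
  [forall v, if v == r then f v == r else sadj v (f v)].

Definition parent_map f : bool := rooted_map f && [forall v, fconnect f v r].

Definition parent_edges f : {set {set g}} := [set [set v; f v] | v in [set~ r]].

(** Away from the root it drops by one along a parent map, which makes it the measure for inductions
    and extremal choices. *)
Definition height f v : nat := findex f v r.

Lemma set2_inj u v w z :
  [set u; v] = [set w; z] -> u = w /\ v = z \/ u = z /\ v = w.
Proof.
move=> E.
have: u \in [set w; z] by rewrite -E set21.
have: v \in [set w; z] by rewrite -E set22.
have: w \in [set u; v] by rewrite E set21.
have: z \in [set u; v] by rewrite E set22.
rewrite !inE => Ez Ew Ev Eu; move: Ez Ew Ev Eu.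
by do 4![case/orP => /eqP ?]; subst; auto.
Qed.

Lemma mem_edges u v : ([set u; v] \in edges g) = sadj u v.
Proof.
apply/imsetP/idP => [[[a b]] /= | uv]; last by exists (u, v); rewrite ?inE.
rewrite inE /= => ab /set2_inj[[-> ->] //|[-> ->]].
by rewrite sadj_sym.
Qed.

Lemma edge_rel_sym F : symmetric (edge_rel F).
Proof. by move=> u v; rewrite /edge_rel /= setUC. Qed.

Lemma parent_edgesP f u v :
  reflect (u != r /\ v = f u \/ v != r /\ u = f v)
          ([set u; v] \in parent_edges f).
Proof.
apply: (iffP imsetP) => [[w] | [[ur ->]|[vr ->]]].
- rewrite !inE => wr /set2_inj[[-> ->]|[-> ->]]; first by left.
  by right.
- by exists u; rewrite ?inE.
- by exists v; rewrite ?inE // setUC.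
Qed.

Section OneParentMap.
Variable f : {ffun g -> g}.
Hypothesis pf : parent_map f.

Lemma parent_root : f r = r.
Proof. by case/andP: pf => /forallP/(_ r); rewrite eqxx => /eqP. Qed.

Lemma parent_adj v : v != r -> sadj v (f v).
Proof. by move=> vr; case/andP: pf => /forallP/(_ v); rewrite (negPf vr). Qed.

Lemma heightS v : v != r -> height f v = (height f (f v)).+1.
Proof.
move=> vr; apply: fconnect_findex; last by rewrite eq_sym.
by case/andP: pf => _ /forallP/(_ v).
Qed.

Lemma parent_ind (P : g -> Prop) :
  P r -> (forall v, v != r -> P (f v) -> P v) -> forall v, P v.
Proof.
move=> Pr PS v; have [k] := ubnP (height f v).
elim: k v => // k IH v; have [-> //|vr] := eqVneq v r.
by rewrite heightS // => hv; apply: PS => //; apply: IH.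
Qed.

Lemma parent_edges_sub : parent_edges f \subset edges g.
Proof.
by apply/subsetP => e /imsetP[v]; rewrite !inE => vr ->; rewrite mem_edges parent_adj.
Qed.

Lemma parent_edges_connected : connected_rel (edge_rel (parent_edges f)).
Proof.
have toroot v : connect (edge_rel (parent_edges f)) v r.
  elim/parent_ind: v => // v vr; apply: connect_trans; apply: connect1.
  by apply/parent_edgesP; left.
apply/forallP => u; apply/forallP => v; apply: connect_trans (toroot u) _.
by rewrite (sym_connect_sym (@edge_rel_sym _)).
Qed.

(* A vertex of maximal height on a cycle has its parent as its only possible
   neighbour on the cycle. *)
Lemma parent_edges_acyclic : acyclic_rel (edge_rel (parent_edges f)).
Proof.
apply/acyclicP => s s_gt2 /andP[cs us].
have [v0 v0s] : exists v0, v0 \in s.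
  by case: s s_gt2 {cs us} => // v0 s _; exists v0; rewrite mem_head.
case: (arg_maxnP (height f) v0s) => v vs vmax.
have nb w : w \in s -> [set v; w] \in parent_edges f -> w = f v.
  move=> ws /parent_edgesP[[]//|[wr vE]].
  by have := vmax w ws; rewrite /= (heightS wr) -vE ltnn.
case: (rot_to vs) => i p rotE.
have ps w : w \in p -> w \in s by move=> wp; rewrite -(mem_rot i) rotE inE wp orbT.
move: s_gt2 cs us; rewrite -(size_rot i) -(rot_cycle i) -(rot_uniq i) rotE /=.
case: p ps {rotE} => [//|a [//|b p]] ps _ /=.
rewrite rcons_path -/(edge_rel _ _ _) => /and4P[va _ _ lv] /and3P[_ aNp _].
have lp : last b p \in b :: p by apply: mem_last.
have av : a = f v by apply: nb va; apply: ps; rewrite mem_head.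
have lf : last b p = f v.
  by apply: nb; [apply: ps; rewrite inE lp orbT | rewrite setUC].
by rewrite av -lf lp in aNp.
Qed.

Lemma parent_edges_tree : is_spanning_tree (parent_edges f).
Proof.
by rewrite /is_spanning_tree parent_edges_sub parent_edges_connected
  parent_edges_acyclic.
Qed.

End OneParentMap.

(** Induction from the root. If [h] agrees with [f] at [f v] but not at [v], the edge from [v] to
    [f v] can only come from [h (f v) = v]. Then [f (f v) = v], and the height of [v] exceeds itself
    by two. *)
Lemma parent_edges_inj : {in parent_map &, injective parent_edges}.
Proof.
move=> f h pf ph E; apply/ffunP; elim/(parent_ind pf) => [|v vr IH].
  by rewrite !parent_root.
have: [set v; f v] \in parent_edges h by rewrite -E; apply/parent_edgesP; left.
case/parent_edgesP => [[//]|[fvr vE]].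
have := heightS pf vr; rewrite (heightS pf fvr) IH -vE.
by move/eqP; rewrite -addn2 -[X in X == _]addn0 eqn_add2l.
Qed.

(** [D] is the length of a shortest path to [r], and [w] is the first step of such a path. *)
Lemma distance_exists (e : rel g) : (forall v, connect e v r) ->
  exists D : g -> nat, forall v, v != r -> exists2 w, e v w & D w < D v.
Proof.
move=> e_conn.
pose P v k := [exists p : k.-tuple g, path e v p && (last v p == r)].
have exP v : exists k, P v k.
  have /connectP[p pp pl] := e_conn v.
  by exists (size p); apply/existsP; exists (in_tuple p); rewrite /= pp -pl eqxx.
exists (fun v => ex_minn (exP v)) => v vr.
case: (ex_minnP (exP v)) => k /existsP[[[|w p] /= /eqP kE]].
  by rewrite (negPf vr).
case/andP=> /andP[vw wp] pl _; exists w => //.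
case: ex_minnP => l _; rewrite -kE ltnS; apply.
by apply/existsP; exists (in_tuple p); rewrite /= wp.
Qed.

(** The parent of [v] is a neighbour in [F] closer to [r]. The parent edges lie in [F] and already
    connect all vertices, so a further edge of [F] would close a cycle. *)
Lemma tree_parent_map F :
  is_spanning_tree F -> exists2 f, parent_map f & F = parent_edges f.
Proof.
case/and3P => Fsub Fconn Facyc.
have e_conn v : connect (edge_rel F) v r by move/forallP: Fconn => /(_ v)/forallP.
have eadj u v : edge_rel F u v -> sadj u v.
  by rewrite -mem_edges => uv; apply: (subsetP Fsub).
have [D Dr] := distance_exists e_conn.
(* Away from the root the [pick] always succeeds, by the choice of [D]. *)
pose f := [ffun v => if v == r then r else
                     odflt r [pick w | edge_rel F v w && (D w < D v)]].
have fr : f r = r by rewrite ffunE eqxx.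
have fP v : v != r -> edge_rel F v (f v) && (D (f v) < D v).
  move=> vr; rewrite ffunE (negPf vr); case: pickP => [w //|no].
  by have [w vw wD] := Dr v vr; have := no w; rewrite vw wD.
have pf : parent_map f.
  apply/andP; split; apply/forallP => v.
    by case: eqVneq => [->|/fP/andP[/eadj]//]; rewrite fr.
  have [k] := ubnP (D v); elim: k v => // k IH v; have [-> //|vr] := eqVneq v r.
  move=> Dv; have /andP[_ lt] := fP v vr.
  by apply: connect_trans (fconnect1 _ _) (IH _ (leq_trans lt Dv)).
exists f => //; apply/eqP; rewrite eqEsubset; apply/andP; split; last first.
  by apply/subsetP => e /imsetP[v]; rewrite !inE => /fP/andP[vF _] ->.
apply/subsetP => e eF; have /imsetP[[u v]] := subsetP Fsub e eF.
rewrite inE /= => uv eE; subst e; apply: contraT => eN.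
have /forallP/(_ u)/forallP/(_ v)/connectP[p pp] := parent_edges_connected pf.
case: (shortenP pp) => q pq uq _ vE.
have subF : subrel (edge_rel (parent_edges f)) (edge_rel F).
  move=> a b /parent_edgesP[[ar ->]|[br ->]]; first by case/andP: (fP a ar).
  by rewrite edge_rel_sym; case/andP: (fP b br).
have := elimT (acyclicP _) Facyc (u :: q).
(* The path has at least two edges: an empty one would give [u = v], and a single edge would be the
   excluded one. *)
case: q pq uq vE => [|a [|b q]] pq uq vE.
- by rewrite vE /= sadj_irr in uv.
- by move: pq eN; rewrite vE /= andbT {1}/edge_rel /= => ->.
case=> //; apply/andP; split=> //.
change (is_true (path (edge_rel F) u (rcons [:: a, b & q] u))).
rewrite rcons_path.
have -> : path (edge_rel F) u [:: a, b & q] = true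
  by apply: sub_path subF _ _ pq.
by rewrite -vE /edge_rel /= setUC.
Qed.

Lemma num_spanning_trees_parent :
  num_spanning_trees g = #|[set f | parent_map f]|.
Proof.
rewrite -(card_in_imset (f := parent_edges)); last first.
  by move=> f h; rewrite !inE => pf ph; apply: parent_edges_inj.
apply: eq_card => F; rewrite inE; apply/idP/imsetP.
  by case/tree_parent_map => f pf ->; exists f; rewrite ?inE.
by case=> f; rewrite inE => pf ->; apply: parent_edges_tree.
Qed.

End ParentFunctions.

(** * Matrices over a finite index type and rank-one updates *)

Section FinMatrix.
Local Open Scope ring_scope.
Variables (R : comNzRingType) (V : finType).
Implicit Types A B : V -> V -> R.

Definition fmx A : 'M[R]_#|V| := \matrix_(i, j) A (enum_val i) (enum_val j).

Lemma big_enum_valT (T : Type) (idx : T) (op : Monoid.com_law idx) (P : pred V)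
    (E : V -> T) :
  \big[op/idx]_(i < #|V| | P (enum_val i)) E (enum_val i) = \big[op/idx]_(v | P v) E v.
Proof. by rewrite [RHS](reindex _ (onW_bij _ (enum_val_bij V))). Qed.

Lemma eq_fmx A B : A =2 B -> fmx A = fmx B.
Proof. by move=> E; apply/matrixP => i j; rewrite !mxE. Qed.

Lemma mul_fmx A B : fmx A *m fmx B = fmx (fun u v => \sum_w A u w * B w v).
Proof.
apply/matrixP => i j; rewrite !mxE -big_enum_valT.
by apply: eq_bigr => k _; rewrite !mxE.
Qed.

(** Sylvester's identity: a unitriangular block matrix intertwines two block triangular matrices
    whose determinants are the two sides. *)
Lemma det_add1_mul (p q : nat) (A : 'M[R]_(p, q)) (B : 'M[R]_(q, p)) :
  \det (1%:M + A *m B) = \det (1%:M + B *m A).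
Proof.
have E : block_mx (1%:M + A *m B) A 0 1%:M *m block_mx 1%:M 0 (- B) 1%:M
         = block_mx 1%:M 0 (- B) 1%:M *m block_mx 1%:M A 0 (1%:M + B *m A).
  rewrite !mulmx_block !mulmx1 !mul1mx !mulmx0 !mul0mx !addr0 !add0r.
  by rewrite mulmxN addrK mulNmx addrC addrK.
have /eqP := congr1 determinant E.
by rewrite !det_mulmx !det_ublock !det_lblock !det1 !mulr1 !mul1r => /eqP.
Qed.

Lemma det_fmx_add1_rank1 (a b : V -> R) :
  \det (fmx (fun u v => (u == v)%:R + a u * b v)) = 1 + \sum_v a v * b v.
Proof.
pose A : 'cV[R]_#|V| := \col_i a (enum_val i).
pose B : 'rV[R]_#|V| := \row_i b (enum_val i).
have -> : fmx (fun u v => (u == v)%:R + a u * b v) = 1%:M + A *m B.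
  apply/matrixP => i j; rewrite !mxE big_ord1 !mxE.
  by rewrite (inj_eq enum_val_inj).
rewrite det_add1_mul det_mx11 !mxE eqxx; congr (_ + _).
by rewrite -big_enum_valT; apply: eq_bigr => k _; rewrite !mxE mulrC.
Qed.

Lemma fmx_mul_add1_rank1 A (a b : V -> R) :
  fmx A *m fmx (fun u v => (u == v)%:R + a u * b v)
  = fmx (fun u v => A u v + (\sum_w A u w * a w) * b v).
Proof.
rewrite mul_fmx; apply: eq_fmx => u v.
under eq_bigr do rewrite mulrDr mulrA.
rewrite big_split /= mulr_suml; congr (_ + _).
rewrite (bigD1 v) //= eqxx mulr1 big1 ?addr0 // => w /negPf->.
by rewrite mulr0.
Qed.

Lemma fmx_add1_rank1_mul A (a b : V -> R) :
  fmx (fun u v => (u == v)%:R + a u * b v) *m fmx A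
  = fmx (fun u v => A u v + a u * (\sum_w b w * A w v)).
Proof.
rewrite mul_fmx; apply: eq_fmx => u v.
under eq_bigr do rewrite mulrDl -mulrA.
rewrite big_split /= mulr_sumr; congr (_ + _).
rewrite (bigD1 u) //= eqxx mul1r big1 ?addr0 // => w.
by rewrite eq_sym => /negPf->; rewrite mul0r.
Qed.

End FinMatrix.

(** * A rooted matrix-tree theorem *)

Section MatrixTree.
Local Open Scope ring_scope.
Variables (F : fieldType) (g : sgraph) (r : g).
Implicit Type f : {ffun g -> g}.

(** The identity minus the adjacency matrix of the arcs from [v] to [f v], with no arc leaving
    [r]. *)
Definition parent_laplacian f : g -> g -> F :=
  fun u v => (u == v)%:R - ((u != r) && (f u == v))%:R.

(* In the Leibniz expansion, a permutation other than the identity whose term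
   is nonzero moves along f, hence has no moved point of maximal height. *)
Lemma det_parent_map f : parent_map r f -> \det (fmx (parent_laplacian f)) = 1.
Proof.
move=> pf; rewrite /determinant (bigD1 1%g) //= odd_perm1 expr0 mul1r.
rewrite [X in X + _]big1 => [|i _]; last first.
  rewrite perm1 mxE /parent_laplacian eqxx; case: eqP => [|/eqP vr] /=; first
    by rewrite subr0.
  have := parent_adj pf vr.
  by case: eqP => [->|_ _]; rewrite ?sadj_irr ?subr0.
rewrite big1 ?addr0 // => s s1.
have [i0 si0] : exists i, s i != i.
  apply/existsP; apply: contraNT s1 => /existsPn no.
  by apply/eqP/permP => i; rewrite perm1; apply/eqP; move: (no i); rewrite negbK.
pose P i := s i != i; pose h (i : 'I_#|g|) := height r f (enum_val i).
case: (@arg_maxnP _ i0 P h si0) => i si imax.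
(* With [j] the preimage of [i], a nonzero off-diagonal entry at [(j, i)] makes [i] the parent of
   [j], so [j] is higher than [i]. *)
have := permKV s i; set j := (s^-1)%g i => sj.
have sjj : P j by rewrite /P sj; apply: contra si => /eqP E; rewrite {1}E sj.
rewrite (bigD1 j) //= sj mxE /parent_laplacian (inj_eq enum_val_inj).
rewrite /P sj eq_sym in sjj; rewrite (negPf sjj).
have [/andP[jr /eqP fj]|_] := boolP (_ && _); last by rewrite subr0 mul0r mulr0.
have := imax j; rewrite /P sj eq_sym => /(_ sjj).
by rewrite /h (heightS pf jr) fj /= ltnn.
Qed.

(* The indicator of the vertices that f does not lead to r is in the kernel. *)
Lemma det_not_parent_map f :
  rooted_map r f -> ~~ parent_map r f -> \det (fmx (parent_laplacian f)) = 0.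
Proof.
move=> rf; rewrite /parent_map rf /= => /forallPn[v0 v0r].
have fr : f r = r by move/forallP: rf => /(_ r); rewrite eqxx => /eqP.
(* [det0P] yields a row vector; transposing turns it into a column vector of the kernel. *)
rewrite -det_tr; apply/eqP/det0P.
pose x v : F := (~~ fconnect f v r)%:R.
exists (\row_i x (enum_val i)).
  apply/eqP => /rowP/(_ (enum_rank v0)); rewrite !mxE enum_rankK /x v0r.
  by move/eqP; rewrite oner_eq0.
apply/rowP => i; rewrite !mxE; set v := enum_val i.
have -> : \sum_j (\row_i x (enum_val i)) 0 j * (fmx (parent_laplacian f))^T j i
          = \sum_w x w * parent_laplacian f v w.
  by rewrite -[RHS]big_enum_valT; apply: eq_bigr => j _; rewrite !mxE.
under eq_bigr do rewrite mulrBr.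
rewrite sumrB (bigD1 v) //= eqxx mulr1 big1 ?addr0; last first.
  by move=> w; rewrite eq_sym => /negPf->; rewrite mulr0.
have [->|vr] := eqVneq v r.
  by rewrite /x connect0 big1 ?subr0 // => w _; rewrite mulr0.
rewrite (bigD1 (f v)) //= eqxx mulr1 big1 ?addr0; last first.
  by move=> w; rewrite eq_sym => /negPf->; rewrite mulr0.
suff -> : x v = x (f v) by rewrite subrr.
rewrite /x; congr (~~ _)%:R; apply/idP/idP => [vc|]; last first.
  by apply: connect_trans; apply: fconnect1.
by move: (iter_findex vc); rewrite fconnect_findex // 1?eq_sym // iterSr => <-;
  apply: fconnect_iter.
Qed.

(** Its determinant is the usual principal cofactor of the Laplacian, obtained without deleting a
    vertex. *)
Definition rooted_laplacian : g -> g -> F := fun u v =>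
  if u == r then (u == v)%:R
  else (u == v)%:R * (\sum_w (sadj u w)%:R) - (sadj u v)%:R.

(** Row [u] is the sum over [w] of [c u w] times the row that [parent_laplacian] has when [f u = w].
    Distributing the products gives a sum over all maps [f], in which the product of the [c v (f v)]
    is the indicator of rooted maps. *)
Lemma rooted_matrix_tree :
  (num_spanning_trees g)%:R = \det (fmx rooted_laplacian).
Proof.
pose c (u w : g) : F := (if u == r then w == r else sadj u w)%:R.
have LE : rooted_laplacian =2
    (fun u v => \sum_w c u w * ((u == v)%:R - ((u != r) && (w == v))%:R)).
  move=> u v; rewrite /rooted_laplacian /c; case: eqVneq => [->|ur] /=.
    rewrite (bigD1 r) //= eqxx mul1r subr0 big1 ?addr0 // => w /negPf->.
    by rewrite mul0r.
  under [RHS]eq_bigr do rewrite mulrBr.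
  rewrite sumrB -mulr_suml mulrC; congr (_ - _).
  rewrite (bigD1 v) //= eqxx mulr1 big1 ?addr0 // => w /negPf->.
  by rewrite mulr0.
rewrite (eq_fmx LE) /determinant.
have detE (s : 'S_#|g|) :
    \prod_i fmx (fun u v => \sum_w c u w * ((u == v)%:R - ((u != r) && (w == v))%:R))
              i (s i)
    = \sum_(f : {ffun g -> g}) (\prod_v c v (f v)) *
        \prod_i fmx (parent_laplacian f) i (s i).
  pose sv v := enum_val (s (enum_rank v)).
  transitivity (\prod_v \sum_w c v w * ((v == sv v)%:R - ((v != r) && (w == sv v))%:R)).
    by rewrite -[RHS]big_enum_valT; apply: eq_bigr => i _; rewrite mxE /sv enum_valK.
  rewrite bigA_distr_bigA; apply: eq_bigr => f _; rewrite big_split; congr (_ * _).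
  by rewrite -[LHS]big_enum_valT; apply: eq_bigr => i _; rewrite mxE /sv enum_valK.
under eq_bigr => s _ do rewrite detE mulr_sumr.
rewrite exchange_big /= (num_spanning_trees_parent r) -sum1_card natr_sum big_mkcond.
apply: eq_bigr => f _; rewrite inE.
transitivity ((\prod_v c v (f v)) * \det (fmx (parent_laplacian f))); last first.
  by rewrite /determinant mulr_sumr; apply: eq_bigr => s _; rewrite mulrCA.
have [rf|nrf] := boolP (rooted_map r f); last first.
  have [v vNr] := forallPn nrf; rewrite /parent_map (negPf nrf) /= (bigD1 v) //= /c.
  by case: eqP vNr => _ /negPf->; rewrite !mul0r.
rewrite big1 => [|v _]; last first.
  by rewrite /c; move/forallP: rf => /(_ v); case: ifP => _ ->.
rewrite mul1r; case: ifP => [pf|/negbT npf]; first by rewrite det_parent_map.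
by rewrite det_not_parent_map.
Qed.

End MatrixTree.

(** * Spanning trees of a clique joined to disjoint cliques *)

Section CliqueJoin.
Local Open Scope ring_scope.
(** [c] sends the central clique to [None] and the [i]-th outer clique to [Some i]. *)
Variables (g : sgraph) (t : nat) (c : g -> option 'I_t) (r : g).
Hypothesis adjE : forall u v : g,
  sadj u v = (u != v) && [|| c u == None, c v == None | c u == c v].
Hypothesis cr : c r = None.

Let m := #|[pred v | c v == None]|.
Let b i := #|[pred v | c v == Some i]|.
Let n := #|g|.

Let sum_class o : \sum_v (c v == o)%:R = #|[pred v | c v == o]|%:R :> rat.
Proof.
by rewrite -natr_sum -sum1_card [in RHS]big_mkcond.
Qed.

Let m_neq0 : m%:R != 0 :> rat.
Proof.
by rewrite pnatr_eq0 -lt0n; apply/card_gt0P; exists r; rewrite inE cr.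
Qed.

Let n_neq0 : n%:R != 0 :> rat.
Proof. by rewrite pnatr_eq0 -lt0n; apply/card_gt0P; exists r. Qed.

Let mb_neq0 i : (m + b i)%:R != 0 :> rat.
Proof. by move: m_neq0; rewrite !pnatr_eq0 -!lt0n addn_gt0 => ->. Qed.

(** Sizes of closed neighbourhoods, one more than the degrees. *)
Let deg (o : option 'I_t) : rat := if o is Some i then (m + b i)%:R else n%:R.
Let diag u := if u == r then 1 else deg (c u).
Let y u : rat := (c u != None)%:R.
Let same u v : rat := ((c u != None) && (c u == c v))%:R.

Let sum_y : \sum_v y v = n%:R - m%:R.
Proof.
rewrite -sum_class /n -sum1_card natr_sum -sumrB.
by apply: eq_bigr => v _; rewrite /y; case: eqP; rewrite ?subrr ?subr0.
Qed.

(** Read backwards, adjacency with loops is the all-ones matrix minus a rank-one term plus the block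
    matrix [same]. *)
Let y_mul u v : y u * y v =
  1 - [|| c u == None, c v == None | c u == c v]%:R + same u v.
Proof.
rewrite /y /same; case: (c u) => [i|] /=; case: (c v) => [j|] /=;
  rewrite ?mulr0 ?mul0r ?mulr1 ?subrr ?addr0 //.
by rewrite addrNK.
Qed.

Let laplacianE u v : u != r -> rooted_laplacian rat r u v
  = (u == v)%:R * deg (c u) - 1 + y u * y v - same u v.
Proof.
move=> ur; rewrite /rooted_laplacian (negPf ur) y_mul.
(* Here [a] is adjacency with loops; the loops change degree and diagonal equally, so they cancel in
   the Laplacian. *)
pose a w : rat := [|| c u == None, c w == None | c u == c w]%:R.
have adj_a w : (sadj u w)%:R = a w - (u == w)%:R.
  by rewrite adjE /a; case: eqVneq => [->|_] /=; rewrite ?eqxx ?orbT ?subrr ?subr0.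
have -> : \sum_w (sadj u w)%:R = deg (c u) - 1.
  under eq_bigr do rewrite adj_a.
  rewrite sumrB; congr (_ - _); last first.
    by rewrite (bigD1 u) //= eqxx big1 ?addr0 // => w; rewrite eq_sym => /negPf->.
  rewrite /a /deg; case: (c u) => [i|] /=; last by rewrite -natr_sum sum1_card.
  rewrite natrD -!sum_class -big_split; apply: eq_bigr => w _ /=.
  by case: (c w) => [j|]; rewrite /= ?add0r ?addr0 // eq_sym.
by rewrite adj_a /a; ring.
Qed.

(** The exponent is [m - 1] because the root, a central vertex, contributes 1. *)
Let prod_diag : \prod_v diag v = n%:R ^+ (m - 1) * \prod_i (m + b i)%:R ^+ b i.
Proof.
rewrite (partition_big c predT) //= (bigD1 None) //=; congr (_ * _).
  rewrite (bigD1 r) ?cr //= {1}/diag eqxx mul1r.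
  rewrite (eq_bigr (fun=> n%:R)) => [|v /andP[/eqP cv /negPf vr]]; last first.
    by rewrite /diag vr cv.
  rewrite prodr_const /m [in RHS](cardD1 r) [r \in _]inE cr add1n subn1; congr (_ ^+ _).
  by apply: eq_card => v; rewrite !inE unfold_in /= andbC.
rewrite (reindex_omap Some id) => [|[i|] //].
apply: eq_big => [i|i _]; first by rewrite eqxx.
rewrite (eq_bigr (fun=> (m + b i)%:R)) ?prodr_const // => v /eqP cv.
by rewrite /diag cv; case: eqP => // vr; rewrite vr cr in cv.
Qed.

Let H u v : rat := (u == v)%:R * diag u - same u v.

(** Factoring out the diagonal leaves [1 + U W], and Sylvester's identity passes to the [t] by [t]
    matrix [1 + W U]. The latter is diagonal by disjointness of the cliques, with entries
    [1 - b i / (m + b i)]. *)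
Let det_H : \det (fmx H)
  = n%:R ^+ (m - 1) * \prod_i ((m + b i)%:R ^+ b i * (m%:R / (m + b i)%:R)).
Proof.
pose U : 'M[rat]_(#|g|, t) :=
  \matrix_(k, i) (- ((c (enum_val k) == Some i)%:R / (m + b i)%:R)).
pose W : 'M[rat]_(t, #|g|) := \matrix_(i, k) (c (enum_val k) == Some i)%:R.
have -> : fmx H = diag_mx (\row_k diag (enum_val k)) *m (1%:M + U *m W).
  apply/matrixP => k l; rewrite mul_diag_mx !mxE /H (inj_eq enum_val_inj).
  rewrite mulrDr mulrC; congr (_ + _).
  under eq_bigr do rewrite !mxE mulNr.
  move: (enum_val k) (enum_val l) => u v.
  rewrite sumrN mulrN /same; congr (- _).
  case cu: (c u) => [i|] /=; last by rewrite big1 ?mulr0 // => j _; rewrite !mul0r.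
  rewrite (bigD1 i) //= eqxx mul1r big1 ?addr0; last first.
    by move=> j ji; rewrite eqE /= eq_sym (negPf ji) !mul0r.
  rewrite /diag cu; case: (u =P r) => [ur|_]; first by rewrite ur cr in cu.
  by rewrite /= mulVKf // eq_sym.
rewrite det_mulmx det_diag det_add1_mul.
have -> : \prod_i (\row_(k < #|g|) diag (enum_val k)) 0 i = \prod_v diag v.
  by rewrite -[RHS]big_enum_valT; apply: eq_bigr => k _; rewrite mxE.
rewrite prod_diag big_split /= mulrA; congr (_ * _).
have -> : 1%:M + W *m U = diag_mx (\row_i (m%:R / (m + b i)%:R)).
  apply/matrixP => i j; rewrite !mxE.
  transitivity ((i == j)%:R - (\sum_v (c v == Some i)%:R * (c v == Some j)%:R)
                              / (m + b j)%:R : rat).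
    rewrite mulr_suml -sumrN -[in RHS]big_enum_valT; congr (_ + _).
    by apply: eq_bigr => k _; rewrite !mxE mulrN mulrA.
  case: (eqVneq i j) => [->|ij]; last first.
    rewrite big1 ?mul0r ?subr0 ?mulr0n // => v _; case: (eqVneq (c v)) => [->|_].
      by rewrite mul1r eqE /= (negPf ij).
    by rewrite mul0r.
  rewrite mulr1n (eq_bigr (fun v => (c v == Some j)%:R)); last first.
    by move=> v _; rewrite -natrM mulnb andbb.
  rewrite sum_class -/(b j) -{1}(mulfV (mb_neq0 j)) -mulrBl natrD addrK //.
by rewrite det_diag; apply: eq_bigr => i _; rewrite mxE.
Qed.

(* With J the all-ones matrix of the vertices other than r and y the indicator
   of the vertices outside the central clique, clearing column r of the rooted
   Laplacian by row operations and multiplying by I + J gives H + y y^T, which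
   is also H (I + y y^T / m) because H y = m y. *)
Lemma clique_join_spanning_trees : (0 < t)%N -> (forall i, 0 < b i)%N ->
  num_spanning_trees g
  = (n ^ (m - 1) * m ^ (t - 1) * \prod_(i < t) (b i + m) ^ (b i - 1))%N.
Proof.
move=> t_gt0 b_gt0; pose z u : rat := (u != r)%:R; pose e u : rat := (u == r)%:R.
pose L := rooted_laplacian rat r.
have L_r v : L r v = (r == v)%:R by rewrite /L /rooted_laplacian eqxx.
have rowL u v : L u v + z u * (\sum_w e w * L w v) = L u v + z u * (r == v)%:R.
  rewrite (bigD1 r) //= /e eqxx mul1r L_r big1 ?addr0 // => w /negPf->.
  by rewrite mul0r.
have factorization : fmx (fun u v => (u == v)%:R + z u * e v) *m fmx L
    *m fmx (fun u v => (u == v)%:R + z u * z v)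
  = fmx H *m fmx (fun u v => (u == v)%:R + y u * (y v / m%:R)).
  rewrite fmx_add1_rank1_mul !fmx_mul_add1_rank1; apply: eq_fmx => u v.
  rewrite rowL; under eq_bigr do rewrite rowL.
  (* On the [i]-th clique the diagonal entry [m + b i] meets the row sum [b i] of [same]. *)
  have -> : \sum_w H u w * y w = m%:R * y u.
    rewrite /H; under eq_bigr do rewrite mulrBl.
    rewrite sumrB (bigD1 u) //= eqxx mul1r big1 ?addr0; last first.
      by move=> w; rewrite eq_sym => /negPf->; rewrite !mul0r.
    rewrite /same /y; case cu: (c u) => [i|] /=; last first.
      by rewrite mulr0 big1 ?subr0 ?mulr0 // => w _; rewrite mul0r.
    rewrite (eq_bigr (fun w => (c w == Some i)%:R)); last first.
      by move=> w _; rewrite eq_sym; case: eqP => [->|]; rewrite ?mulr1 ?mul0r.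
    rewrite sum_class -/(b i) !mulr1 /diag cu /=.
    by case: (u =P r) => [ur|_]; [rewrite ur cr in cu | rewrite natrD addrK].
  have -> : m%:R * y u * (y v / m%:R) = y u * y v by field.
  have [->|ur] := eqVneq u r.
    rewrite L_r /z eqxx !mul0r addr0 big1 => [|w _]; last first.
      by rewrite L_r mul0r addr0; case: eqVneq; rewrite ?mul0r ?mulr0.
    by rewrite /H /diag /same /y cr eqxx /= !mul0r mulr1 subr0 addr0.
  (* Row [u] of the Laplacian sums to 0 and its entry at the central vertex [r] is -1. *)
  have -> : \sum_w (L u w + z u * (r == w)%:R) * z w = 1.
    have L0 : \sum_w L u w = 0.
      rewrite /L /rooted_laplacian (negPf ur) sumrB -mulr_suml.
      rewrite (bigD1 u) //= eqxx big1 ?addr0 ?mul1r ?subrr // => w.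
      by rewrite eq_sym => /negPf->.
    rewrite (bigD1 r) //= /z eqxx mulr0 add0r.
    rewrite (eq_bigr (L u)) => [|w wr]; last first.
      by rewrite [r == w]eq_sym (negPf wr) mulr0 addr0 mulr1.
    move: L0; rewrite (bigD1 r) //= => /eqP; rewrite addr_eq0 => /eqP.
    rewrite /L /rooted_laplacian (negPf ur) mul0r sub0r adjE ur cr orbT /=.
    by move/oppr_inj => <-.
  rewrite /L laplacianE // /H /diag (negPf ur) mul1r /z ur /=.
  have -> : (v != r)%:R = 1 - (r == v)%:R :> rat.
    by rewrite eq_sym; case: eqP; rewrite ?subrr ?subr0.
  by ring.
(* The rank-one factors have determinants 1, [n] and [n / m], from the inner products of [z] with
   [e], of [z] with itself, and of [y] with [y / m]. *)
have detE : \det (fmx L) * n%:R = \det (fmx H) * (n%:R / m%:R).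
  have := congr1 determinant factorization; rewrite !det_mulmx !det_fmx_add1_rank1.
  rewrite big1 ?addr0 ?mul1r => [|v _]; last first.
    by rewrite /z /e; case: eqP; rewrite ?mulr0 ?mul0r.
  have -> : 1 + \sum_v z v * z v = n%:R.
    rewrite /n -sum1_card natr_sum (bigD1 r) //= [RHS](bigD1 r) //= /z eqxx mul0r add0r.
    by congr (_ + _); apply: eq_bigr => v ->; rewrite mulr1.
  have -> : 1 + \sum_v y v * (y v / m%:R) = n%:R / m%:R.
    rewrite (eq_bigr (fun v => y v / m%:R)) => [|v _]; last first.
      by rewrite mulrA /y -natrM mulnb andbb.
    by rewrite -mulr_suml sum_y mulrBl mulfV // addrC subrK.
  by [].
apply/eqP; rewrite -(eqr_nat rat) (rooted_matrix_tree rat r) -/L; apply/eqP.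
have prodE : \prod_i ((m + b i)%:R ^+ b i * (m%:R / (m + b i)%:R))
    = m%:R ^+ t * \prod_(i < t) (b i + m)%:R ^+ (b i - 1) :> rat.
  rewrite -[t in m%:R ^+ t]card_ord -prodr_const -big_split.
  apply: eq_bigr => i _ /=; rewrite mulrCA [(b i + m)%N]addnC; congr (_ * _).
  (* Positivity of [b i] lets one factor [m + b i] cancel. *)
  by rewrite -[X in _ ^+ X](prednK (b_gt0 i)) exprSr mulfK // subn1.
apply: (mulIf n_neq0); rewrite detE det_H prodE !natrM !natrX natr_prod.
under [in RHS]eq_bigr do rewrite natrX.
(* Since [t > 0], one factor [m] can be split off to cancel the denominator of [n / m]. *)
have -> : m%:R ^+ t = m%:R ^+ (t - 1) * m%:R :> rat by rewrite -exprSr -addn1 subnK.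
by field.
Qed.

End CliqueJoin.

(** * Centralizers and the commuting graph of an AC-group *)

Section ACGroup.
Local Open Scope group_scope.
Variables (gT : finGroupType) (G : {group gT}).

Lemma card_subg_pred (P : pred gT) :
  #|[pred v : subg_of G | P (sgval v)]| = #|[set y in G | P y]|.
Proof.
rewrite -(card_imset _ (@subg_inj _ G)); apply: eq_card => y.
rewrite inE; apply/imsetP/andP => [[v]|[yG Py]].
  by rewrite inE => Pv ->; rewrite subgP.
by exists (subg G y); rewrite ?inE subgK.
Qed.

(** If [y] and [z] commute, [z] lies in the abelian group ['C_G[y]], all of which therefore
    centralizes [z]; by symmetry the centralizers agree. Conversely [y] lies in its own
    centralizer. *)
Lemma AC_cent_eq (y z : gT) : AC_group G ->
  y \in G :\: 'Z(G) -> z \in G :\: 'Z(G) ->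
  ('C_G[y] == 'C_G[z]) = (y * z == z * y).
Proof.
case/andP => _ /forall_inP abC.
have sub u v : u \in G :\: 'Z(G) -> v \in G -> u * v = v * u -> 'C_G[u] \subset 'C_G[v].
  move=> uN vG uv; have := abC u uN; rewrite /abelian => /subsetP abu.
  have vC : v \in 'C_G[u] by rewrite inE vG; apply/cent1P.
  apply/subsetP => w wC; rewrite inE (subsetP (subsetIl _ _) w wC) /=.
  by apply/cent1P; have /centP/(_ v vC) := abu w wC.
move=> yN zN; have /setDP[yG _] := yN; have /setDP[zG _] := zN.
apply/eqP/eqP => [E|yz]; last by apply/eqP; rewrite eqEsubset !sub.
have: y \in 'C_G[z] by rewrite -E inE yG cent1id.
by case/setIP => _ /cent1P.
Qed.

End ACGroup.

Theorem theorem4p3 (gT : finGroupType) (G : {group gT}) (n m t : nat)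
    (x : 'I_t -> gT) (m_ : 'I_t -> nat)
    (hAC : AC_group G)
    (hn : #|G| = n)
    (hm : #|'Z(G)%g| = m)
    (hx : forall i, x i \in G :\: 'Z(G)%g)
    (hx_inj : injective (fun i => 'C_G[x i]%g))
    (hx_all : forall y, y \in G :\: 'Z(G)%g -> exists i, 'C_G[y]%g = 'C_G[x i]%g)
    (hm_ : forall i, m_ i = #|'C_G[x i]%g :\: 'Z(G)%g|) :
  kappa G = n ^ (m - 1) * m ^ (t - 1) * \prod_(i < t) (m_ i + m) ^ (m_ i - 1)
  /\ ('Z(G)%g = 1%g ->
      kappa G = \prod_(i < t) (m_ i + 1) ^ (m_ i - 1)
      /\ \prod_(i < t) (m_ i + 1) ^ (m_ i - 1)
         = \prod_(i < t) #|'C_G[x i]%g| ^ (#|'C_G[x i]%g| - 2)).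
Proof.
(* Noncentral vertices are coloured by their centralizer; [hx_all] ensures that [pick] succeeds on
   them. *)
pose c (v : commuting_graph G) : option 'I_t :=
  if sgval v \in 'Z(G)%g then None else [pick i | 'C_G[sgval v]%g == 'C_G[x i]%g].
have noncentral (v : subg_of G) : sgval v \notin 'Z(G)%g -> sgval v \in G :\: 'Z(G)%g.
  by move=> vZ; rewrite inE vZ subgP.
have c_noncentral (v : commuting_graph G) : sgval v \notin 'Z(G)%g ->
    exists2 i, c v = Some i & 'C_G[sgval v]%g = 'C_G[x i]%g.
  move=> vZ; rewrite /c (negPf vZ); case: pickP => [i /eqP E|no]; first by exists i.
  by have [i E] := hx_all _ (noncentral v vZ); have := no i; rewrite E eqxx.
have c_None v : (c v == None) = (sgval v \in 'Z(G)%g).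
  apply/idP/idP => [|vZ]; last by rewrite /c vZ.
  by apply: contraTT => /c_noncentral[i ->].
have c_Some v i : (c v == Some i) = (sgval v \in 'C_G[x i]%g :\: 'Z(G)%g).
  rewrite inE; have [vZ|vZ] /= := boolP (sgval v \in 'Z(G)%g); first by rewrite /c vZ.
  have [j -> E] := c_noncentral v vZ; rewrite -[LHS](inj_eq hx_inj) -E.
  by rewrite AC_cent_eq ?noncentral // inE subgP cent1E.
have adjE (u v : commuting_graph G) :
    sadj u v = (u != v) && [|| c u == None, c v == None | c u == c v].
  rewrite !c_None /=; congr (_ && _); rewrite -(inj_eq (@subg_inj _ G)) /=.
  have [/centerP[_ uZ]|uZ] /= := boolP (sgval u \in 'Z(G)%g).
    by apply/eqP; apply: uZ; apply: subgP.
  have [/centerP[_ vZ]|vZ] /= := boolP (sgval v \in 'Z(G)%g).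
    by apply/eqP/esym; apply: vZ; apply: subgP.
  have [i -> Eu] := c_noncentral u uZ; have [j -> Ev] := c_noncentral v vZ.
  by rewrite -[RHS](inj_eq hx_inj) -Eu -Ev AC_cent_eq ?noncentral.
(* The identity is central and serves as the root. *)
have c1 : c (1%g : subg_of G) = None by apply/eqP; rewrite c_None group1.
have card_None : #|[pred v | c v == None]| = m.
  rewrite -hm (eq_card (B := [pred v : subg_of G | sgval v \in 'Z(G)%g])).
    rewrite card_subg_pred; apply: eq_card => y; rewrite inE andb_idl //.
    by apply: (subsetP (center_sub G)).
  by move=> v; apply: c_None.
have card_Some i : #|[pred v | c v == Some i]| = m_ i.
  rewrite hm_ (eq_card (B := [pred v : subg_of G | sgval v \in 'C_G[x i]%g :\: 'Z(G)%g])).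
    rewrite card_subg_pred; apply: eq_card => y; rewrite inE andb_idl //.
    by case/setDP => /setIP[].
  by move=> v; apply: c_Some.
have card_V : #|commuting_graph G| = n.
  rewrite -hn (card_subg_pred G predT); apply: eq_card => y.
  by rewrite inE andbT.
have m_gt0 i : 0 < m_ i.
  rewrite hm_; apply/card_gt0P; exists (x i).
  by have /setDP[xG xZ] := hx i; rewrite inE xZ inE xG cent1id.
have t_gt0 : 0 < t.
  (* A group contained in its center would be abelian. *)
  have [y yG yZ] : exists2 y, y \in G & y \notin 'Z(G)%g.
    apply/subsetPn; case/andP: hAC => + _; apply: contra => sZ.
    exact: abelianS sZ (center_abelian G).
  have [i _] : exists i, 'C_G[y]%g = 'C_G[x i]%g by apply: hx_all; rewrite inE yZ.
  exact: leq_ltn_trans (ltn_ord i).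
have b_gt0 i : 0 < #|[pred v | c v == Some i]| by rewrite card_Some.
have kappaE : kappa G
    = n ^ (m - 1) * m ^ (t - 1) * \prod_(i < t) (m_ i + m) ^ (m_ i - 1).
  rewrite /kappa (clique_join_spanning_trees adjE c1 t_gt0 b_gt0) card_None card_V.
  by congr (_ * _); apply: eq_bigr => i _; rewrite card_Some.
split=> // Z1; have m1 : m = 1 by rewrite -hm Z1 cards1.
split; first by rewrite kappaE m1 subnn expn0 exp1n !mul1n.
apply: eq_bigr => i _.
(* With trivial center, the centralizer has only the identity besides its noncentral elements. *)
have -> : #|'C_G[x i]%g| = m_ i + 1.
  by rewrite hm_ Z1 addn1 [LHS](cardsD1 1%g) group1 add1n.
by rewrite -[2]/(1 + 1) subnDr.
Qed.
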